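(* Let $\rho=v_0,v_1,\dots,v_n$ be a path graph with edge privacy parameters $\varepsilon_i=\varepsilon(v_i,v_{i+1})>0$ for $0\le i\le n-1$, let $\alpha\in[0,1]$, and suppose $T(v_i)=1$ for $1\le i\le n$. Let $\tau$ be the smallest index $i\in\{0,1,\dots,n-1\}$ such that $\alpha\, e^{\varepsilon_{0}+\varepsilon_1+\dots+\varepsilon_{i-1}}(e^{\varepsilon_i}+1)\ge 1$ (with an empty sum equal to $0$), and $\tau=n$ if no such index exists. Then the optimal binary-valued heterogeneous differentially private mechanism $p^*$ on $\rho$ with $p^*(v_0)=\alpha$ is given by $$p^*(v_i)=\begin{cases} e^{\varepsilon_{i-1}+\dots+\varepsilon_0}\,\alpha, & i\le\tau,\\ e^{-\varepsilon_{i-1}-\dots-\varepsilon_{\tau}+\varepsilon_{\tau-1}+\dots+\varepsilon_0}\,\alpha+1-e^{-\varepsilon_{i-1}-\dots-\varepsilon_\tau}, & i>\tau.\end{cases}$$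
   Context: A function $q:\{v_0,\dots,v_n\}\to[0,1]$ is binary-valued heterogeneous $\varepsilon(\cdot)$-differentially private on the path if for every $0\le i\le n-1$: $q(v_i)\le e^{\varepsilon_i}q(v_{i+1})$, $q(v_{i+1})\le e^{\varepsilon_i}q(v_i)$, $1-q(v_i)\le e^{\varepsilon_i}(1-q(v_{i+1}))$ and $1-q(v_{i+1})\le e^{\varepsilon_i}(1-q(v_i))$. The optimal mechanism with $p^*(v_0)=\alpha$ is the unique binary-valued heterogeneous $\varepsilon(\cdot)$-DP function $p^*$ on the path with $p^*(v_0)=\alpha$ such that every binary-valued heterogeneous $\varepsilon(\cdot)$-DP $q$ with $q(v_0)=\alpha$ satisfies $q(v_i)\le p^*(v_i)$ for all $i$ (since $T(v_i)=1$ for $i\ge1$, larger values are better). *)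

(* Defs.v *)
From mathcomp Require Import all_boot all_order all_algebra.
From mathcomp Require Import reals sequences exp.

Set Implicit Arguments.
Unset Strict Implicit.
Unset Printing Implicit Defensive.

Import Order.TTheory GRing.Theory Num.Theory.
Local Open Scope ring_scope.

Section PathMechanisms.
Variables (R : realType) (n : nat).

(* The vertices v_0, ..., v_n are the elements of 'I_n.+1; the edge i : 'I_n
   joins v_i = src i to v_(i+1) = dst i and has privacy parameter eps i. *)
Definition src (i : 'I_n) : 'I_n.+1 := widen_ord (leqnSn n) i.
Definition dst (i : 'I_n) : 'I_n.+1 := lift ord0 i.

(* A binary-valued mechanism is encoded by q v = Pr[output 1 at v]. *)
Definition hetero_dp (eps : 'I_n -> R) (q : 'I_n.+1 -> R) : Prop :=
  (forall v, 0 <= q v <= 1) /\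
  (forall i : 'I_n,
    [/\ q (src i) <= expR (eps i) * q (dst i),
        q (dst i) <= expR (eps i) * q (src i),
        1 - q (src i) <= expR (eps i) * (1 - q (dst i)) &
        1 - q (dst i) <= expR (eps i) * (1 - q (src i))]).

(* T v is the true answer at v: larger values of Pr[output 1] are better
   where T v = 1, smaller ones where T v = 0. *)
Definition at_least_as_good (T : 'I_n.+1 -> bool) (p q : 'I_n.+1 -> R) : Prop :=
  forall v, if T v then q v <= p v else p v <= q v.

Definition dominates_dp (T : 'I_n.+1 -> bool) (eps : 'I_n -> R) (alpha : R)
    (p : 'I_n.+1 -> R) : Prop :=
  [/\ hetero_dp eps p, p ord0 = alpha &
      forall q, hetero_dp eps q -> q ord0 = alpha -> at_least_as_good T p q].

Definition optimal_mechanism (T : 'I_n.+1 -> bool) (eps : 'I_n -> R) (alpha : R)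
    (p : 'I_n.+1 -> R) : Prop :=
  unique (dominates_dp T eps alpha) p.

(* eps_a + ... + eps_(b-1), equal to 0 when b <= a *)
Definition eps_sum (eps : 'I_n -> R) (a b : nat) : R :=
  \sum_(k < n | (a <= k < b)%N) eps k.

(* [find] returns the first index satisfying the test, and
   size (enum 'I_n) = n when there is none. *)
Definition tau (eps : 'I_n -> R) (alpha : R) : nat :=
  find (fun i : 'I_n =>
          1 <= alpha * expR (eps_sum eps 0 i) * (expR (eps i) + 1))
       (enum 'I_n).

End PathMechanisms.

(* Main.v *)
(** Write [E_i = expR (eps i)]. The two upper constraints on the edge [i] say
  that [q (dst i) <= E_i * q (src i)] and
  [q (dst i) <= 1 - (1 - q (src i)) / E_i]. Both bounds are nondecreasing in
  [q (src i)], so a mechanism that always attains the smaller one dominates by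
  induction along the path. The first bound is the smaller one exactly when
  [q (src i) * (E_i + 1) <= 1]. This switches only once: after the first edge
  where it fails the value is at least [1 / 2] and never decreases. *)
Require Import Defs.
From mathcomp Require Import all_boot all_order all_algebra.
From mathcomp Require Import boolp reals sequences exp.
From mathcomp Require Import zify lra.

Set Implicit Arguments.
Unset Strict Implicit.
Unset Printing Implicit Defensive.

Import Order.TTheory GRing.Theory Num.Theory.
Local Open Scope ring_scope.

Lemma eps_sum_self (R : realType) (n : nat) (eps : 'I_n -> R) (a : nat) :
  eps_sum eps a a = 0.
Proof. by rewrite /eps_sum big1 // => k /andP[ak]; rewrite ltnNge ak. Qed.

Lemma eps_sumS (R : realType) (n : nat) (eps : 'I_n -> R) (a : nat)
    (i : 'I_n) :
  (a <= i)%N -> eps_sum eps a i.+1 = eps_sum eps a i + eps i.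
Proof.
move=> ai; rewrite /eps_sum (bigD1 i) ?ai ?ltnSn //= addrC; congr (_ + _).
apply: eq_bigl => k; rewrite -val_eqE /=; lia.
Qed.

Lemma tau_min (R : realType) (n : nat) (eps : 'I_n -> R) (alpha : R)
    (i : 'I_n) : (i < tau eps alpha)%N ->
  alpha * expR (eps_sum eps 0 i) * (expR (eps i) + 1) < 1.
Proof.
by move=> /(before_find i); rewrite nth_ord_enum => /negbT; rewrite -ltNge.
Qed.

Lemma tau_test (R : realType) (n : nat) (eps : 'I_n -> R) (alpha : R)
    (i : 'I_n) : tau eps alpha = i ->
  1 <= alpha * expR (eps_sum eps 0 i) * (expR (eps i) + 1).
Proof.
rewrite /tau; set P := (P in find P _) => taui.
(* The value [n], returned when no edge passes the test, is excluded since [i < n]. *)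
have : has P (enum 'I_n) by rewrite has_find taui size_enum_ord.
by move=> /(nth_find i); rewrite taui nth_ord_enum.
Qed.

Section OptimalPath.
Variables (R : realType) (n : nat) (eps : 'I_n -> R) (alpha : R).
Hypothesis eps_gt0 : forall i : 'I_n, 0 < eps i.
Hypothesis alpha01 : 0 <= alpha <= 1.

Let t := tau eps alpha.

Definition path_opt (k : nat) : R :=
  if (k <= t)%N then expR (eps_sum eps 0 k) * alpha
  else expR (- eps_sum eps t k + eps_sum eps 0 t) * alpha
       + 1 - expR (- eps_sum eps t k).

Lemma path_opt0 : path_opt 0 = alpha.
Proof. by rewrite /path_opt leq0n eps_sum_self expR0 mul1r. Qed.

Lemma path_optSl (i : 'I_n) : (i < t)%N ->
  path_opt i.+1 = expR (eps i) * path_opt i.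
Proof.
move=> it; rewrite /path_opt it (ltnW it) eps_sumS // expRD.
by rewrite mulrCA mulrA.
Qed.

(** Past [t] the formula is affine in [alpha]; passing to complements turns it into a pure product,
    so each later edge just divides by [expR (eps i)]. *)
Lemma path_opt_compl (k : nat) : (t <= k)%N ->
  1 - path_opt k = expR (- eps_sum eps t k) * (1 - expR (eps_sum eps 0 t) * alpha).
Proof.
rewrite /path_opt leq_eqVlt => /predU1P[<-|tk].
  by rewrite leqnn eps_sum_self oppr0 expR0 mul1r.
by rewrite leqNgt tk /= expRD; lra.
Qed.

Lemma path_optSr (i : 'I_n) : (t <= i)%N ->
  expR (eps i) * (1 - path_opt i.+1) = 1 - path_opt i.
Proof.
move=> ti; rewrite !path_opt_compl ?(leqW ti) // eps_sumS // mulrA -expRD.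
by congr (expR _ * _); lra.
Qed.

Lemma path_opt_below (i : 'I_n) : (i < t)%N ->
  path_opt i * (expR (eps i) + 1) < 1.
Proof.
by move=> it; have := tau_min it; rewrite /path_opt (ltnW it) [alpha * _]mulrC.
Qed.

(** At [i = t] this is the test defining [tau]; later, a value at least 1/2 suffices because
    [expR (eps i) + 1 > 2]. The value bound stays a premise so that the induction of
    [path_opt_bounds] can supply it. *)
Lemma path_opt_above_half (i : 'I_n) :
  (t <= i)%N -> ((t < i)%N -> 1 <= 2 * path_opt i) ->
  1 <= path_opt i * (expR (eps i) + 1).
Proof.
have E1 : 1 < expR (eps i) by rewrite expR_gt1.
rewrite leq_eqVlt => /predU1P[ti _|ti /(_ ti) half]; last by nra.
by have := tau_test ti; rewrite /path_opt -ti leqnn [alpha * _]mulrC.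
Qed.

Lemma path_opt_bounds (k : nat) : (k <= n)%N ->
  0 <= path_opt k <= 1 /\ ((t < k)%N -> 1 <= 2 * path_opt k).
Proof.
elim: k => [_|k IH kn]; first by rewrite path_opt0.
have [/andP[x0 x1] xhalf] := IH (ltnW kn).
pose i := Ordinal kn.
have E1 : 1 < expR (eps i) by rewrite expR_gt1.
have [kt|tk] := ltnP k t.
  have yE := @path_optSl i kt; have lt1 := @path_opt_below i kt.
  rewrite /= in yE lt1; split; last by move=> tk; lia.
  by rewrite yE; apply/andP; split; nra.
have yE := @path_optSr i tk; have ge1 := @path_opt_above_half i tk xhalf.
rewrite /= in yE ge1; split; first by apply/andP; split; nra.
(* With [E = expR (eps i)], the new complement is [(1 - path_opt k) / E], at most
   [1 / (E + 1) < 1/2]. *)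
by move=> _; nra.
Qed.

Lemma path_opt_above (i : 'I_n) : (t <= i)%N ->
  1 <= path_opt i * (expR (eps i) + 1).
Proof.
move=> ti; apply: path_opt_above_half => //.
by have [] := path_opt_bounds (ltnW (ltn_ord i)).
Qed.

Lemma path_opt_dp : hetero_dp eps (fun v => path_opt v).
Proof.
split=> [v|i]; first by have [] := @path_opt_bounds v (ltn_ord v).
have E1 : 1 < expR (eps i) by rewrite expR_gt1.
have [/andP[x0 x1] _] := path_opt_bounds (ltnW (ltn_ord i)).
have [/andP[y0 y1] _] := path_opt_bounds (ltn_ord i).
rewrite /= /bump leq0n add1n.
have [it|ti] := ltnP i t.
  have yE := path_optSl it; have lt1 := path_opt_below it.
  by rewrite yE in y0 y1 *; split; nra.
have yE := path_optSr ti; have ge1 := path_opt_above ti.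
move: yE ge1 x0 x1 y0 y1 E1; move: (path_opt i) (path_opt i.+1) (expR _).
move=> x y E yE ge1 x0 x1 y0 y1 E1.
(* The bound [y <= E * x] is where the switching test enters: eliminating [y] by [yE] leaves the
   test as a factor. *)
have yEx : E * (E * x - y) = (E - 1) * (x * (E + 1) - 1) by nra.
split; [nra| |nra|nra].
rewrite -subr_ge0 -(pmulr_rge0 _ (lt_trans ltr01 E1)) yEx.
by apply: mulr_ge0; lra.
Qed.

Lemma path_opt_ge (q : 'I_n.+1 -> R) (v : 'I_n.+1) :
  hetero_dp eps q -> q ord0 = alpha -> q v <= path_opt v.
Proof.
move=> [_ qdp] q0; case: v => k; elim: k => [|k IH] kn /=.
  by rewrite path_opt0 -q0 (_ : Ordinal kn = ord0) //; apply: val_inj.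
pose i := Ordinal (kn : (k < n)%N).
(* [path_opt] turns [le_mul] into an equality before [t] and [le_compl] from [t] on. *)
have [_ le_mul le_compl _] := qdp i.
have srcE : src i = Ordinal (ltnW kn) by apply: val_inj.
have dstE : dst i = Ordinal kn by apply: val_inj.
have := IH (ltnW kn); rewrite -srcE -dstE /= => lex.
have E1 : 1 < expR (eps i) by rewrite expR_gt1.
have [kt|tk] := ltnP k t.
  have -> : path_opt k.+1 = expR (eps i) * path_opt k := @path_optSl i kt.
  by nra.
have yE : expR (eps i) * (1 - path_opt k.+1) = 1 - path_opt k :=
  @path_optSr i tk.
by nra.
Qed.

End OptimalPath.

Theorem theorem3 (R : realType) (n : nat) (eps : 'I_n -> R) (alpha : R)
    (T : 'I_n.+1 -> bool)
    (eps_gt0 : forall i : 'I_n, 0 < eps i)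
    (alpha01 : 0 <= alpha <= 1)
    (T1 : forall v : 'I_n.+1, (1 <= v)%N -> T v = true) :
  let t := tau eps alpha in
  optimal_mechanism T eps alpha
    (fun v : 'I_n.+1 =>
       if (v <= t)%N then expR (eps_sum eps 0 v) * alpha
       else expR (- eps_sum eps t v + eps_sum eps 0 t) * alpha
            + 1 - expR (- eps_sum eps t v)).
Proof.
move=> t; change (optimal_mechanism T eps alpha (fun v => path_opt eps alpha v)).
(* [T ord0] is arbitrary, but at [ord0] all competitors equal [alpha], so the comparison holds in
   either direction. *)
have vertexP (v : 'I_n.+1) : v = ord0 \/ T v.
  by have [v0|/T1] := posnP v; [left; apply: val_inj|right].
have opt_dp := path_opt_dp eps_gt0 alpha01.
have opt0 := path_opt0 eps alpha.
split=> [|p [pdp p0 pmax]].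
  split=> // q qdp q0 v; case: (vertexP v) => [->|Tv].
    by rewrite q0 opt0 lexx if_same.
  by rewrite Tv; apply: path_opt_ge.
(* Uniqueness: two dominating mechanisms bound each other pointwise. *)
apply/funext => v; case: (vertexP v) => [->|Tv]; first by rewrite p0.
by have := pmax _ opt_dp opt0 v; rewrite Tv => le_opt; apply/le_anti;
  rewrite le_opt path_opt_ge.
Qed.
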